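(* Let $\mathcal G$ be a random graph on the vertex set $V$ which satisfies the BK inequality, and suppose that for some $\alpha\in(d/2,d)$ there exists $C_0>0$ such that $\tau(x,y)\le C_0\, g_\alpha(x,y)$ for all $x,y\in V$. There exists a constant $C>0$ such that for any $n\ge1$ and any $x_1,\dots,x_n,z\in V$, one has with $\underline x=(x_1,\dots,x_n)$, $$\mathbb P(x_1,\dots,x_n\in\mathcal C(z))\le C^n\sum_{\mathfrak t\in\mathbb T_n}G_\alpha(\mathfrak t,\underline x)\cdot g_\alpha(x_{\mathfrak t},z).$$
   Context: $(V,d_V)$ is a countable metric space, with balls $B(x,r)=\{y\in V: d_V(x,y)\le r\}$, of polynomial volume growth: there are a real $d\ge 1$ and constants $c_1,c_2>0$ with $c_1 r^d\le |B(x,r)|\le c_2 r^d$ for all $x\in V$, $r\ge 1$. $\mathcal G$ is a random graph with deterministic vertex set $V$ and possibly random edge set; $\{x\longleftrightarrow y\}$ is the event that $x$ and $y$ are connected in $\mathcal G$, $\tau(x,y)=\mathbb P(x\longleftrightarrow y)$, and $\mathcal C(z)=\{y\in V:z\longleftrightarrow y\}$. For $\beta>0$, $g_\beta(x,y)=\frac{1}{1+d_V(x,y)^\beta}$. BK inequality: an event $E$ is increasing if whenever $\{\mathcal G=A\}\subseteq E$ for a fixed graph $A$ with vertex set $V$, then $\{\mathcal G=B\}\subseteq E$ for every graph $B$ on $V$ containing $A$ as a subgraph. A finite graph $A$ witnesses $E$ if $\{A\subseteq\mathcal G\}\subseteq E$. For increasing events $E,F$, $E\circ F$ is the event that there exist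 two finite subgraphs of $\mathcal G$ with disjoint edge sets, one witnessing $E$ and the other witnessing $F$. $\mathcal G$ satisfies the BK inequality if $\mathbb P(E\circ F)\le \mathbb P(E)\,\mathbb P(F)$ for all increasing events $E,F$. Trees: in a finite plane (rooted, ordered) tree, call a vertex marked if it has zero or one child. $\mathbb T_n$ is the set of finite plane trees with exactly $n$ marked vertices, endowed with a bijective labelling of the marked vertices by $\{1,\dots,n\}$ (one similarly considers labellings by any finite set of integers $I$ with $|I|=n$, identified with $\{1,\dots,n\}$ by the order-preserving bijection). For $\mathfrak t\in\mathbb T_n$, $x_{\mathfrak t}=x_i$ where $i$ is the label of the first marked vertex of $\mathfrak t$ in lexicographical (depth-first) order. To $\mathfrak t$ one associates an unordered rooted tree $\pi(\mathfrak t)$ on $n$ vertices carrying distinct labels (the labels of $\mathfrak t$), defined inductively: - if $n=1$, $\pi(\mathfrak t)=\mathfrak t$ is the one-vertex tree; - if $n\ge2$ and the root of $\mathfrak t$ is marked, the root has exactly one child, the root of a subtree $\mathfrak t'$ with $n-1$ marked vertices; $\pi(\mathfrak t)$ is obtained from $\pi(\mathfrak t')$ by adding a new vertex with the label of the root of $\mathfrak t$, joining it by an edge to the root of $\pi(\mathfrak t')$, and declaring it to be the root; - if the root of $\mathfrak t$ is not marked, it has $L\ge2$ children, in order, roots of subtrees $\mathfrak t_1,\dots,\mathfrak t_L$ (each with at most $n-1$ marked vertices); $\pi(\mathfrak t)$ is obtained from the disjoint union of $\pi(\mathfrak t_1),\dots,\pi(\mathfrak t_L)$ by joining the root of $\pi(\mathfrak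 t_i)$ to the root of $\pi(\mathfrak t_{i+1})$ by an edge for each $1\le i\le L-1$, and declaring the root of $\pi(\mathfrak t_1)$ to be the root. Identifying vertices of $\pi(\mathfrak t)$ with their labels, and with $\mathcal E(\pi(\mathfrak t))$ its edge set, $$G_\alpha(\mathfrak t,\underline x)=\prod_{\{i,j\}\in\mathcal E(\pi(\mathfrak t))}g_{2\alpha-d}(x_i,x_j),$$ with $G_\alpha(\mathfrak t,x_1)=1$ if $\mathfrak t$ has only one vertex. *)

(* Defs.v *)
From HB Require Import structures.
From mathcomp Require Import all_boot all_order all_algebra.
From mathcomp Require Import all_classical all_reals all_analysis.
Import Order.TTheory GRing.Theory Num.Theory.
Import numFieldNormedType.Exports.

Set Implicit Arguments.
Unset Strict Implicit.
Unset Printing Implicit Defensive.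

Local Open Scope classical_set_scope.
Local Open Scope ring_scope.

(* The library's [closed_ball] is the closure of the open ball, which in a
   discrete space may be strictly smaller than {y | d_V(x, y) <= r}. *)
Definition ballV {R : realType} {V : metricType R} (x : V) (r : R) : set V :=
  [set y | mdist x y <= r].

(* [counting B] is the cardinality of [B] in [\bar R], +oo if [B] is infinite. *)
Definition volume_growth {R : realType} (V : metricType R) (d c1 c2 : R) : Prop :=
  forall (x : V) (r : R), 1 <= r ->
    ((c1 * r `^ d)%:E <= (counting (ballV x r) : \bar R))%E /\
    ((counting (ballV x r) : \bar R) <= (c2 * r `^ d)%:E)%E.

Definition g_kernel {R : realType} {V : metricType R} (beta : R) (x y : V) : R :=
  1 / (1 + mdist x y `^ beta).

Record sgraph (V : Type) := SGraph {
  adj :> rel V;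
  adj_sym : symmetric adj;
  adj_irrefl : irreflexive adj }.

Definition empty_graph (V : Type) : sgraph V :=
  @SGraph V (fun _ _ => false) (fun _ _ => erefl) (fun _ => erefl).

HB.instance Definition _ (V : Type) := gen_eqMixin (sgraph V).
HB.instance Definition _ (V : Type) := gen_choiceMixin (sgraph V).
HB.instance Definition _ (V : Type) := isPointed.Build (sgraph V) (empty_graph V).

(* The product sigma-algebra on graphs: the one generated by the events
   "{x, y} is an edge". *)
Definition edge_events (V : Type) : set (set (sgraph V)) :=
  [set E | exists x y : V, E = [set A : sgraph V | A x y]].

Notation graph_space V := (g_sigma_algebraType (@edge_events V)).

Definition subgraph {V : Type} (A B : sgraph V) : Prop :=
  forall x y, A x y -> B x y.

(* Finitely many edges. Since the vertex set of the random graph is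
   deterministic, isolated vertices play no role in [A \subseteq G], and a
   finite graph is represented by the graph on [V] with the same edges. *)
Definition finite_graph {V : Type} (A : sgraph V) : Prop :=
  finite_set [set e : V * V | A e.1 e.2].

Definition edge_disjoint {V : Type} (A B : sgraph V) : Prop :=
  forall x y, ~ (A x y /\ B x y).

Definition connected_in {V : Type} (A : sgraph V) (x y : V) : Prop :=
  exists p : seq V, path A x p /\ last x p = y.

Definition component {V : Type} (A : sgraph V) (z : V) : set V :=
  [set y | connected_in A z y].

(* Events are identified with sets of graphs, [E] standing for {G \in E}. On the
   space of graphs, {G = A} \subseteq E reads [E A]. *)
Definition increasing {V : Type} (E : set (sgraph V)) : Prop :=
  forall A, E A -> forall B, subgraph A B -> E B.

Definition witnesses {V : Type} (A : sgraph V) (E : set (sgraph V)) : Prop :=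
  [set H | subgraph A H] `<=` E.

Definition disjoint_occ {V : Type} (E F : set (sgraph V)) : set (sgraph V) :=
  [set H | exists A B : sgraph V,
    [/\ finite_graph A /\ finite_graph B, subgraph A H /\ subgraph B H,
        edge_disjoint A B & witnesses A E /\ witnesses B F]].

Definition BK_inequality {R : realType} {disp : measure_display}
    {Omega : measurableType disp} {V : Type}
    (P : probability Omega R) (G : {mfun Omega >-> graph_space V}) : Prop :=
  forall E F : set (graph_space V), measurable E -> measurable F ->
    increasing E -> increasing F ->
    (P (G @^-1` disjoint_occ E F) <= P (G @^-1` E) * P (G @^-1` F))%E.

Definition tau {R : realType} {disp : measure_display}
    {Omega : measurableType disp} {V : Type}
    (P : probability Omega R) (G : {mfun Omega >-> graph_space V})
    (x y : V) : \bar R :=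
  P [set w | connected_in (G w) x y].

(* Plane trees whose marked vertices carry a label in [I]: a vertex has either
   no child (marked), one child (marked), or at least two ordered children
   (not marked). *)
Inductive ltree (I : Type) :=
| Leaf of I
| Unary of I & ltree I
| Branch of ltree I & ltree I & seq (ltree I).

HB.instance Definition _ (I : Type) := gen_eqMixin (ltree I).
HB.instance Definition _ (I : Type) := gen_choiceMixin (ltree I).

(* Labels of the marked vertices, in depth-first order. *)
Fixpoint labels {I : Type} (t : ltree I) : seq I :=
  match t with
  | Leaf i => [:: i]
  | Unary i t' => i :: labels t'
  | Branch t1 t2 ts =>
      labels t1 ++ labels t2 ++ flatten [seq labels t' | t' <- ts]
  end.

Fixpoint first_label {I : Type} (t : ltree I) : I :=
  match t with
  | Leaf i => i
  | Unary i _ => i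
  | Branch t1 _ _ => first_label t1
  end.

Lemma labels_cons (I : Type) (t : ltree I) :
  labels t = first_label t :: behead (labels t).
Proof. by elim: t => //= t1 -> t2 _ ts. Qed.

(* The labels {1, ..., n} are represented by ['I_n]. *)
Definition plane_trees (n : nat) : set (ltree 'I_n) :=
  [set t | perm_eq (labels t) (enum 'I_n)].

Arguments plane_trees : clear implicits.

(* Rooted trees, given by their root and their edges {i, j}, each listed once
   as a pair (i, j). *)
Record rtree (I : Type) := RTree { rroot : I; redges : seq (I * I) }.

(* The vertices of [pi_tree t] are the labels of [t]; they are assumed
   distinct. [pairmap pair r0 rs] lists the pairs of consecutive elements of
   [r0 :: rs]. *)
Fixpoint pi_tree {I : Type} (t : ltree I) : rtree I :=
  match t with
  | Leaf i => RTree i [::]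
  | Unary i t' =>
      let p := pi_tree t' in RTree i ((i, rroot p) :: redges p)
  | Branch t1 t2 ts =>
      let p1 := pi_tree t1 in
      let ps := pi_tree t2 :: [seq pi_tree t' | t' <- ts] in
      RTree (rroot p1)
        (pairmap pair (rroot p1) [seq rroot p | p <- ps] ++
         flatten [seq redges p | p <- p1 :: ps])
  end.

Definition G_tree {R : realType} {V : metricType R} (alpha d : R) {n : nat}
    (t : ltree 'I_n) (x : 'I_n -> V) : R :=
  \prod_(e <- redges (pi_tree t)) g_kernel (2 * alpha - d) (x e.1) (x e.2).

(* Main.v *)
Require Import Defs.
From HB Require Import structures.
From mathcomp Require Import all_boot all_order all_algebra.
From mathcomp Require Import all_classical all_reals all_analysis.
From mathcomp Require Import lra.
Import Order.TTheory GRing.Theory Num.Theory.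
Import numFieldNormedType.Exports.

Set Implicit Arguments.
Unset Strict Implicit.
Unset Printing Implicit Defensive.

Local Open Scope classical_set_scope.
Local Open Scope ring_scope.

(** The proof is an induction on the number of points, in the manner of the
tree-graph inequality of Aizenman and Newman; it produces only the trees of
[plane_trees n] that are binary and whose marked vertices are the leaves.

Suppose that z is connected to all x_i with i in S, and S has at least two
elements. Then there are a vertex w and a splitting of S into two nonempty parts
J and S \ J such that the three connections from z to w, from w to the points of
J and from w to the points of S \ J occur on disjoint sets of edges
([branch_point], [hits_disjoint_occ]). A union bound over w and J
([hits_union_bound]) and two applications of the BK inequality ([BK_branch])
bound the probability by the sum over w and J of
  tau(z, w) P(x_J is hit from w) P(x_(S \ J) is hit from w).

By induction the last two factors are at most sums over binary trees t1 and t2,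
and they depend on w only through g_alpha(x_t1, w) and g_alpha(x_t2, w). What
remains is a three-point star sum, bounded in [star_sum]:
  sum_w g_alpha(z, w) g_alpha(x, w) g_alpha(y, w)
    <= C g_(2 alpha - d)(x, y) (g_alpha(x, z) + g_alpha(y, z)).
With x = x_t1 and y = x_t2 the two terms on the right are the weights of the
trees obtained by grafting t1 and t2, in either order, on an unmarked root: the
new edge of [pi_tree] joins the roots of t1 and t2, and the first label is that
of the tree placed first ([branch_sum]). Each step costs a fixed constant, and
there are at most n - 1 of them along the construction of a tree with n leaves,
whence C^n.

The star sum reduces to the convolution estimate
  sum_w g_alpha(x, w) g_alpha(y, w) <= C g_(2 alpha - d)(x, y),
which follows from the volume growth on dyadic shells: d / 2 < alpha makes the
contribution of large distances summable and alpha < d makes that of small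
distances increasing ([geometric_min], [convolution]). *)

(** * Connectivity and branch points *)

Lemma connected_refl (V : eqType) (A : sgraph V) x : connected_in A x x.
Proof. by exists [::]. Qed.

Lemma connected_trans (V : eqType) (A : sgraph V) y x z :
  connected_in A x y -> connected_in A y z -> connected_in A x z.
Proof.
move=> [p [pp lp]] [q [pq lq]]; exists (p ++ q).
by rewrite cat_path pp lp pq last_cat lp.
Qed.

Lemma connected_adj (V : eqType) (A : sgraph V) (x y : V) :
  A x y -> connected_in A x y.
Proof. by move=> Axy; exists [:: y]; rewrite /= Axy. Qed.

(** Induction principle along paths: the way to use a connection is to exhibit a
set of vertices that no edge leaves. *)
Lemma connected_closed (V : eqType) (A : sgraph V) (S : set V) x y :
  (forall u v, S u -> A u v -> S v) -> S x -> connected_in A x y -> S y.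
Proof.
move=> Scl Sx [p [pp <-]].
elim: p x Sx pp => //= v p IH x Sx /andP[xv pp].
exact: IH (Scl _ _ Sx xv) pp.
Qed.

Lemma connected_sub (V : eqType) (A B : sgraph V) x y :
  subgraph A B -> connected_in A x y -> connected_in B x y.
Proof.
move=> AB; apply: connected_closed (@connected_refl V B x) => u v xu uv.
exact: connected_trans xu (connected_adj (AB _ _ uv)).
Qed.

Definition diff_graph (V : Type) (A B : sgraph V) : sgraph V.
Proof.
exists (fun u v => A u v && ~~ B u v) => [u v|u].
- by rewrite (adj_sym A) (adj_sym B).
- by rewrite adj_irrefl.
Defined.

Definition delete_edge (V : eqType) (A : sgraph V) (z y : V) : sgraph V.
Proof.
exists (fun u v => [&& A u v, (u, v) != (z, y) & (v, u) != (z, y)]) => [u v|u].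
- by rewrite (adj_sym A) [X in _ && X]andbC.
- by rewrite adj_irrefl.
Defined.

Definition component_graph (V : eqType) (A : sgraph V) (z : V) : sgraph V.
Proof.
exists (fun u v => A u v && `[< connected_in A z u >]) => [u v|u].
- rewrite (adj_sym A); case: (boolP (A v u)) => //= vu; apply/asboolP/asboolP.
    by move=> /connected_trans; apply; apply: connected_adj; rewrite adj_sym.
  by move=> /connected_trans; apply; apply: connected_adj.
- by rewrite adj_irrefl.
Defined.

(** After its last passage through the deleted edge, a path from z stays in the
remaining graph, starting from one of the two endpoints. *)
Lemma connected_delete_edge (V : eqType) (A : sgraph V) (z y v : V) :
  connected_in A z v ->
  connected_in (delete_edge A z y) z v \/ connected_in (delete_edge A z y) y v.
Proof.
apply: (@connected_closed V A
  [set v | connected_in (delete_edge A z y) z v \/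
           connected_in (delete_edge A z y) y v]); last first.
  by left; exact: connected_refl.
move=> u {}v /= H uv.
have [[_ ->]|n1] := eqVneq (u, v) (z, y); first by right; exact: connected_refl.
have [[-> _]|n2] := eqVneq (v, u) (z, y); first by left; exact: connected_refl.
have c : connected_in (delete_edge A z y) u v.
  by apply: connected_adj; rewrite /= uv n1 n2.
by case: H => h; [left|right]; exact: connected_trans h c.
Qed.

(** Induction on the size of a list s containing the edges of A. If some x_i is z
itself, branch at z with J = {i}: nothing is needed to reach x_i. Otherwise z
has a neighbour y; delete the edge {z, y} and let J collect the x_i still
connected to z. If J is empty, all of them are connected to y and the branch
point seen from y serves for z; if J is all of S the edge can be dropped; else
z is a branch point, J living in the component of z and the other points being
reached through y, outside of that component.
The path to w is found in the complement of A1 and A2, so that its disjointness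
from them needs no argument. *)
Lemma branch_point (V : eqType) (I : finType) (x : I -> V) (S : {set I})
    (A : sgraph V) (s : seq (V * V)) (z : V) :
  (forall u v, A u v -> (u, v) \in s) ->
  (1 < #|S|)%N -> (forall i, i \in S -> connected_in A z (x i)) ->
  exists w (J : {set I}) (A1 A2 : sgraph V),
    [/\ J \proper S /\ J != finset.set0, subgraph A1 A /\ subgraph A2 A,
        edge_disjoint A1 A2,
        connected_in (diff_graph (diff_graph A A1) A2) z w &
        (forall i, i \in J -> connected_in A1 w (x i)) /\
        (forall i, i \in S :\: J -> connected_in A2 w (x i))].
Proof.
have [m] := ubnP (size s); elim: m s A z => // m IH s A z ltsm As S2 Sz.
have [[i iS xiz]|nz] := pselect (exists2 i, i \in S & x i = z).
  exists z, [set i]%SET, (empty_graph V), A; split => //.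
  - split; last by apply/set0Pn; exists i; rewrite inE.
    by rewrite properEcard finset.sub1set iS cards1.
  - by split.
  - by move=> u v [].
  - exact: connected_refl.
  - split=> j; first by rewrite inE => /eqP ->; rewrite xiz; exact: connected_refl.
    by rewrite inE => /andP[_]; exact: Sz.
have [i0 i0S] : exists i, i \in S by apply/set0Pn; rewrite -card_gt0 ltnW.
have [y zy] : exists y, A z y.
  have [[|y p] [/= pp lp]] := Sz _ i0S; first by case: nz; exists i0.
  by exists y; case/andP: pp.
pose A' := delete_edge A z y.
have A'A : subgraph A' A by move=> u v /and3P[].
have A'm : (size ([seq e <- s | e != (z, y)]) < m)%N.
  rewrite size_filter -ltnS (leq_trans _ ltsm) // ltnS.
  rewrite -(count_predC (fun e => e != (z, y)) s) -[X in (X < _)%N]addn0 ltn_add2l -has_count.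
  by apply/hasP; exists (z, y); [exact: As|rewrite /= negbK].
have A's u v : A' u v -> (u, v) \in [seq e <- s | e != (z, y)].
  by move=> /and3P[uv n1 n2]; rewrite mem_filter /= n1 As.
pose J := [set i in S | `[< connected_in A' z (x i) >]]%SET.
have JS : J \subset S by apply/fintype.subsetP => i; rewrite inE => /andP[].
have [J0|Jn0] := eqVneq J finset.set0.
  have Sy i : i \in S -> connected_in A' y (x i).
    move=> iS; have [h|//] := @connected_delete_edge _ _ _ y _ (Sz i iS).
    by have := finset.in_set0 i; rewrite -J0 inE iS asboolT.
  have [w [K [A1 [A2 [HK [s1 s2] dis cw HJ]]]]] := IH _ A' y A'm A's S2 Sy.
  exists w, K, A1, A2; split => //.
    by split=> u v /[dup] => [/s1|/s2] /A'A.
  (* The deleted edge is in neither A1 nor A2, hence is free to lead to y. *)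
  apply: (@connected_trans _ _ y).
    apply: connected_adj; rewrite /= zy /=; apply/andP; split; apply/negP.
      by move=> /s1; rewrite /= eqxx andbF.
    by move=> /s2; rewrite /= eqxx andbF.
  apply: connected_sub cw => u v /= /andP[/andP[/and3P[-> _ _] ->] ->] //.
have [JeS|JneS] := eqVneq J S.
  have Sy i : i \in S -> connected_in A' z (x i).
    by rewrite -JeS inE => /andP[_ /asboolP].
  have [w [K [A1 [A2 [HK [s1 s2] dis cw HJ]]]]] := IH _ A' z A'm A's S2 Sy.
  exists w, K, A1, A2; split => //.
    by split=> u v => [/s1|/s2] /A'A.
  by apply: connected_sub cw => u v /= /andP[/andP[/and3P[-> _ _] ->] ->].
pose A1 := component_graph A' z.
have A1A : subgraph A1 A by move=> u v /andP[/A'A].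
exists z, J, A1, (diff_graph A A1); split => //.
- by rewrite finset.properEneq JneS JS.
- by split => // u v /andP[].
- by move=> u v [uv /andP[_ /negP]].
- exact: connected_refl.
split=> i.
  rewrite inE => /andP[_ /asboolP zi].
  suff [] : connected_in A1 z (x i) /\ connected_in A' z (x i) by [].
  move: zi; apply: (@connected_closed _ A'
    [set v | connected_in A1 z v /\ connected_in A' z v]).
    move=> u v [h1 h2] uv; split.
      apply: connected_trans h1 (connected_adj _).
      by apply/andP; split; [exact: uv|exact/asboolP].
    exact: connected_trans h2 (connected_adj _).
  by split; exact: connected_refl.
rewrite !inE => /andP[+ iS]; rewrite iS /= => /asboolP nzi.
have [//|yi] := @connected_delete_edge _ _ _ y _ (Sz i iS).
have nzy : ~ connected_in A' z y.
  by move=> zy'; apply: nzi; exact: connected_trans zy' yi.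
(* A path from y to x_i never enters the component of z, so avoids A1. *)
suff [] : connected_in (diff_graph A A1) z (x i) /\ ~ connected_in A' z (x i) by [].
move: yi; apply: (@connected_closed _ A'
  [set v | connected_in (diff_graph A A1) z v /\ ~ connected_in A' z v]).
  move=> u v [h1 h2] uv; split.
    apply: connected_trans h1 (connected_adj _).
    apply/andP; split; first exact: A'A uv.
    by rewrite negb_and; apply/orP; right; apply/asboolPn.
  move=> zv; apply: h2; apply: connected_trans zv (connected_adj _).
  by rewrite adj_sym.
split => //; apply: connected_adj; rewrite /= zy /=.
by rewrite eqxx.
Qed.

(** * Measurability on the space of graphs *)

Definition cylinder (V : Type) (s : seq (V * V)) : set (graph_space V) :=
  [set H : sgraph V | all (fun e => H e.1 e.2) s].

(** Being open for the product topology: every graph in U has a finite set of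
edges that already forces U. This gives measurability of events such as
[disjoint_occ E F], whatever E and F. *)
Definition finitary (V : Type) (U : set (graph_space V)) :=
  forall H, U H -> exists s, cylinder s H /\ cylinder s `<=` U.

Lemma cylinder_measurable (V : Type) (s : seq (V * V)) :
  measurable (cylinder s).
Proof.
elim: s => [|e s IH].
  suff -> : cylinder [::] = setT :> set (graph_space V) by exact: measurableT.
  by apply/seteqP; split.
suff -> : cylinder (e :: s) = [set H : sgraph V | H e.1 e.2] `&` cylinder s.
  apply: measurableI => //; apply: sub_gen_smallest; by exists e.1, e.2.
by apply/seteqP; split => H; rewrite /cylinder /= => /andP.
Qed.

Lemma countable_seq (T : Type) : countable [set: T] -> countable [set: seq T].
Proof.
move=> /countable_injP[f finj].
have {}finj : injective f by move=> a b; apply: finj; rewrite in_setT.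
apply/countable_injP; exists (pickle \o map f) => a b _ _ /=.
by move=> /(pcan_inj pickleK) /(inj_map finj).
Qed.

Lemma countable_pair (T : Type) : countable [set: T] -> countable [set: T * T].
Proof.
move=> /countable_injP[f finj].
have {}finj : injective f by move=> a b; apply: finj; rewrite in_setT.
apply/countable_injP; exists (fun p => pickle (f p.1, f p.2)) => -[a b] [c d] _ _ /=.
by move=> /(pcan_inj pickleK) [/finj -> /finj ->].
Qed.

(** Over a countable vertex set there are countably many cylinders, and a finitary
event is the union of the cylinders that it contains. *)
Lemma finitary_measurable (V : Type) (U : set (graph_space V)) :
  countable [set: V] -> finitary U -> measurable U.
Proof.
move=> cV fU.
have -> : U = \bigcup_s [set H | cylinder s H /\ cylinder s `<=` U].
  apply/seteqP; split => [H /fU [s hs]|H [s _ [hH]]]; first by exists s.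
  exact.
apply: countable_bigcupT_measurable => [|s].
  exact/countable_seq/countable_pair.
have [h|h] := pselect (cylinder s `<=` U).
  suff -> : [set H | cylinder s H /\ cylinder s `<=` U] = cylinder s.
    exact: cylinder_measurable.
  by apply/seteqP; split => [H []|H].
suff -> : [set H | cylinder s H /\ cylinder s `<=` U] = set0 by exact: measurable0.
by apply/seteqP; split => [H []|H].
Qed.

Lemma finitary_connected (V : Type) (x y : V) :
  finitary ([set A : sgraph V | connected_in A x y] : set (graph_space V)).
Proof.
move=> H [p [pp lp]].
suff {lp} [s [sH sp]] : exists s, cylinder s H /\
    forall H' : graph_space V, cylinder s H' -> path (adj H') x p.
  by exists s; split => // H' /sp pp'; exists p.
elim: p x pp => [|v p IH] x /=; first by exists [::].
move=> /andP[xv /IH[s [sH sp]]]; exists ((x, v) :: s).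
split=> [|H' /= /andP[xv' /sp ->]]; last by rewrite xv'.
by rewrite /cylinder /= xv.
Qed.

(** The edges of the two witnesses force the event. *)
Lemma finitary_disjoint_occ (V : eqType) (E F : set (graph_space V)) :
  finitary (disjoint_occ E F : set (graph_space V)).
Proof.
move=> H [A [B [[/finite_seqP[s sA] /finite_seqP[t tB]] [AH BH] AB [wA wB]]]].
exists (s ++ t); split.
  rewrite /cylinder /= all_cat; apply/andP; split; apply/allP => e es.
    have : [set` s] e by []. by rewrite -sA; exact: AH.
  have : [set` t] e by []. by rewrite -tB; exact: BH.
move=> H'; rewrite /cylinder /= all_cat => /andP[/allP sH' /allP tH'].
exists A, B; split => //.
  split; apply/finite_seqP; [by exists s|by exists t].
split=> u v uv.
  apply: (sH' (u, v)). have : [set e | A e.1 e.2] (u, v) by []. by rewrite sA.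
apply: (tH' (u, v)). have : [set e | B e.1 e.2] (u, v) by []. by rewrite tB.
Qed.

Definition hits (V : Type) (I : finType) (x : I -> V) (S : {set I}) (z : V) :
  set (graph_space V) :=
  [set A : sgraph V | forall i, i \in S -> connected_in A z (x i)].

Lemma finitary_hits (V : Type) (I : finType) (x : I -> V) (S : {set I}) z :
  finitary (hits x S z).
Proof.
move=> H SH.
suff [s [sH h]] : exists s, cylinder s H /\ forall H' : graph_space V,
    cylinder s H' -> forall i, i \in enum S -> connected_in H' z (x i).
  exists s; split => // H' /h{}h i iS; apply: h; by rewrite mem_enum.
have {}SH i : i \in enum S -> connected_in H z (x i) by rewrite mem_enum; exact: SH.
elim: (enum S) SH => [|i l IH] SH; first by exists [::].
have [s [sH h]] : exists s, cylinder s H /\ forall H' : graph_space V,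
    cylinder s H' -> forall i, i \in l -> connected_in H' z (x i).
  by apply: IH => j jl; apply: SH; rewrite inE jl orbT.
have [t [tH ht]] := @finitary_connected V z (x i) H (SH i (mem_head _ _)).
exists (t ++ s); rewrite /cylinder /= all_cat; split; first exact/andP.
move=> H'; rewrite all_cat => /andP[/ht h1 /h h2] j.
by rewrite inE => /predU1P[->|/h2].
Qed.

Lemma hits_measurable (V : Type) (I : finType) (x : I -> V) (S : {set I}) z :
  countable [set: V] -> measurable (hits x S z).
Proof. by move=> cV; apply: finitary_measurable => //; exact: finitary_hits. Qed.

Lemma hits_increasing (V : eqType) (I : finType) (x : I -> V) (S : {set I}) z :
  increasing (hits x S z).
Proof. by move=> A hA B AB i /hA; exact: connected_sub. Qed.

Lemma disjoint_occ_measurable (V : eqType) (E F : set (graph_space V)) :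
  countable [set: V] -> measurable (disjoint_occ E F : set (graph_space V)).
Proof. by move=> cV; apply: finitary_measurable => //; exact: finitary_disjoint_occ. Qed.

Lemma disjoint_occ_increasing (V : eqType) (E F : set (graph_space V)) :
  increasing (disjoint_occ E F).
Proof.
move=> H [A [B [fAB [AH BH] dAB wAB]]] H' HH'; exists A, B; split => //.
by split=> u v uv; apply: HH'; [apply: AH|apply: BH].
Qed.

Lemma finite_graph_sub (V : eqType) (A B : sgraph V) :
  subgraph A B -> finite_graph B -> finite_graph A.
Proof. by move=> AB; apply: sub_finite_set => e; exact: AB. Qed.

Definition restrict_graph (V : eqType) (A : sgraph V) (s : seq (V * V)) : sgraph V.
Proof.
exists (fun u v => A u v && (((u, v) \in s) || ((v, u) \in s))) => [u v|u].
- by rewrite (adj_sym A) orbC.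
- by rewrite adj_irrefl.
Defined.

Lemma restrict_graph_finite (V : eqType) (A : sgraph V) (s : seq (V * V)) :
  finite_graph (restrict_graph A s).
Proof.
apply: (@sub_finite_set _ _ [set` s ++ [seq (e.2, e.1) | e <- s]]); last exact: finite_seq.
move=> [u v] /= /andP[_ uv]; rewrite mem_cat; case/orP: uv => [-> //|vu].
by apply/orP; right; apply/mapP; exists (v, u).
Qed.

Lemma restrict_graph_cylinder (V : eqType) (A : sgraph V) (s : seq (V * V)) :
  cylinder s A -> cylinder s (restrict_graph A s).
Proof.
by move=> /allP sA; apply/allP => -[u v] es /=; rewrite es andbT; exact: sA es.
Qed.

(** [branch_point] requires a finite graph, and so does [disjoint_occ]: it is
applied to a finite subgraph of H that still connects z to all the points. *)
Lemma hits_disjoint_occ (V : eqType) (I : finType) (x : I -> V) (S : {set I}) z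
    (H : graph_space V) :
  (1 < #|S|)%N -> hits x S z H ->
  exists w (J : {set I}), [/\ J \proper S, J != finset.set0 &
    disjoint_occ [set A : sgraph V | connected_in A z w]
      (disjoint_occ (hits x J w) (hits x (S :\: J) w)) H].
Proof.
move=> S2 SH.
have [A [fA AH SA]] : exists A : sgraph V, [/\ finite_graph A, subgraph A H &
    forall i, i \in S -> connected_in A z (x i)].
  have [s [sH h]] := finitary_hits SH; exists (restrict_graph H s); split.
  - exact: restrict_graph_finite.
  - by move=> u v /andP[].
  - exact: h (restrict_graph_cylinder sH).
have /finite_seqP[s sA] := fA.
have As u v : A u v -> (u, v) \in s.
  by move=> uv; have : [set e | A e.1 e.2] (u, v) by []; rewrite sA.
have [w [J [A1 [A2 [[JS J0] [s1 s2] dis cw [h1 h2]]]]]] := branch_point As S2 SA.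
exists w, J; split => //.
pose A0 := diff_graph (diff_graph A A1) A2.
have A0A : subgraph A0 A by move=> u v /andP[/andP[]].
pose B := diff_graph A A0.
have BA : subgraph B A by move=> u v /andP[].
exists A0, B; split.
- by split; apply: finite_graph_sub fA.
- by split=> u v => [/A0A|/BA]; exact: AH.
- by move=> u v [uv /andP[_]]; rewrite uv.
split=> H' sH'; first exact: connected_sub cw.
exists A1, A2; split => //.
- by split; apply: finite_graph_sub fA.
- by split=> u v uv; apply: sH' => /=;
    [rewrite (s1 _ _ uv) uv|rewrite (s2 _ _ uv) uv !andbF].
- by split => H'' sH'' i /[dup] iJ => [/h1|/h2]; apply: connected_sub.
Qed.

(** * Convolution estimates *)

Lemma powRN_anti (R : realType) (b u v : R) :
  0 <= b -> 0 < u -> u <= v -> v `^ (- b) <= u `^ (- b).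
Proof.
move=> b0 u0 uv; have v0 := lt_le_trans u0 uv.
by rewrite !powRN lef_pV2 ?posrE ?powR_gt0 // ge0_ler_powR // nnegrE ltW.
Qed.

(** The form in which the triangle inequality is used: of two distances with sum
at least u, the larger one is at least u / 2. *)
Lemma powRN_half (R : realType) (b u v : R) :
  0 <= b -> 0 < u -> u <= 2 * v -> v `^ (- b) <= 2 `^ b * u `^ (- b).
Proof.
move=> b0 u0 uv; have v0 : 0 < v by lra.
have /(powRN_anti b0) : u / 2 <= v by lra.
move/(_ (divr_gt0 u0 (ltr0Sn R 1))) => /le_trans; apply.
rewrite powRM ?invr_ge0 ?(ltW u0) //.
by rewrite -[2^-1]powR_inv1 // -powRrM mulN1r opprK mulrC.
Qed.

Lemma natX_powR (R : realType) (b : R) (k : nat) :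
  (2 ^+ k : R) `^ b = (2 `^ b) ^+ k.
Proof. by rewrite -!powR_mulrn ?powR_ge0 // -!powRrM mulrC. Qed.

Lemma trunc_log2_bounds (R : realType) (u : R) : 1 <= u ->
  let k := trunc_log 2 (Num.trunc u) in 2 ^+ k <= u < 2 ^+ k.+1.
Proof.
move=> u1; have u0 : 0 <= u by lra.
have /andP[tu ut] := truncn_itv u0.
have t0 : (0 < Num.trunc u)%N.
  rewrite lt0n; apply/negP => /eqP t0; move: ut; rewrite t0; lra.
have /andP[h1 h2] := trunc_log_bounds (isT : (1 < 2)%N) t0.
apply/andP; split; first by rewrite (le_trans _ tu) // -natrX ler_nat.
by rewrite (lt_le_trans ut) // -natrX ler_nat.
Qed.

(** Up to k = K the terms are a^k q^K, which increase geometrically; beyond K they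
are (a q)^k, which decrease geometrically. Either way the sum is of the order of
its term at k = K. *)
Lemma geometric_min (R : realType) (a q : R) (K N : nat) :
  1 < a -> 0 < q -> a * q < 1 ->
  \sum_(k < N) a ^+ k * Num.min (q ^+ k) (q ^+ K) <=
  (a / (a - 1) + (1 - a * q)^-1) * (a * q) ^+ K.
Proof.
move=> a1 q0 aq1.
have a0 : 0 < a by lra.
have aq0 : 0 < a * q by exact: mulr_gt0.
have iaq : 0 < (1 - a * q)^-1 by rewrite invr_gt0; lra.
have ia : 0 < (a - 1)^-1 by rewrite invr_gt0; lra.
have iaE : a * (a - 1)^-1 = 1 + (a - 1)^-1.
  by rewrite -[X in X * _](subrK 1) mulrDl mul1r divff //; lra.
pose S n := \sum_(k < n) a ^+ k * Num.min (q ^+ k) (q ^+ K).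
have S1 n : S n <= q ^+ K * a ^+ n / (a - 1).
  elim: n => [|n IH].
    by rewrite /S big_ord0 expr0 mulr1 mulr_ge0 ?exprn_ge0 ?ltW.
  rewrite /S big_ord_recr /=; apply: (le_trans (lerD IH _) _).
    apply: (@ler_wpM2l _ _ _ _ (q ^+ K)); first by rewrite exprn_ge0 ?ltW.
    by rewrite ge_min lexx orbT.
  set X := q ^+ K * a ^+ n; rewrite exprS.
  have ay : X * (a * (a - 1)^-1) = X * (1 + (a - 1)^-1) by rewrite iaE.
  rewrite /X in ay *; lra.
have S2 j : S (K.+1 + j)%N <= q ^+ K * a ^+ K.+1 / (a - 1) +
   (a * q) ^+ K * (1 - (a * q) ^+ j) / (1 - a * q).
  elim: j => [|j IH]; first by rewrite addn0 expr0 subrr mulr0 mul0r addr0 S1.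
  rewrite addnS /S big_ord_recr /=; apply: (le_trans (lerD IH _) _).
    apply: (@ler_wpM2l _ _ _ _ (q ^+ (K.+1 + j))); first by rewrite exprn_ge0 ?ltW.
    by rewrite ge_min lexx.
  rewrite -exprMn addSn !(exprS (a * q)) exprD.
  set A := (a * q) ^+ K; set B := (a * q) ^+ j.
  have AB : 0 <= A * B by rewrite mulr_ge0 ?exprn_ge0 ?ltW.
  rewrite -addrA lerD2l ler_pdivlMr; last lra.
  rewrite mulrDl divfK; last lra.
  have : 0 <= A * B * (1 - a * q) ^+ 2 by rewrite mulr_ge0 ?sqr_ge0.
  rewrite expr2; lra.
have mono m n : (m <= n)%N -> S m <= S n.
  move=> mn; rewrite -(subnKC mn); elim: (n - m)%N => [|j IH]; first by rewrite addn0.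
  rewrite addnS {2}/S big_ord_recr /=; apply: (le_trans IH); rewrite lerDl.
  by rewrite mulr_ge0 ?exprn_ge0 ?le_min ?exprn_ge0 ?ltW.
apply: (le_trans (mono _ _ (leq_addl K.+1 N))); apply: (le_trans (S2 N)).
rewrite mulrDl; apply: lerD.
  rewrite exprS exprMn; lra.
rewrite -mulrA mulrC; apply: ler_wpM2r; first by rewrite exprn_ge0 ?ltW.
rewrite ler_piMl // ?ltW // ; have := exprn_gt0 N aq0; lra.
Qed.

Lemma ball_size (R : realType) (V : metricType R) (d c1 c2 : R)
    (Vg : volume_growth V d c1 c2) (x : V) (r : R) (s : seq V) :
  1 <= r -> uniq s -> (forall w, w \in s -> mdist x w <= r) ->
  (size s)%:R <= c2 * r `^ d.
Proof.
move=> r1 us sr; have [_] := Vg x r r1; rewrite /counting.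
case: asboolP => // fB; rewrite lee_fin => /(le_trans _); apply.
rewrite ler_nat; apply: uniq_leq_size => // w /sr wB.
by rewrite in_fset_set // inE.
Qed.

(** Distances below 1 affect [g_kernel] by a factor at most 2; truncating at 1 lets
exact powers replace it. *)
Definition udist (R : realType) (V : metricType R) (x y : V) : R :=
  Num.max 1 (mdist x y).

Lemma udist_ge1 (R : realType) (V : metricType R) (x y : V) : 1 <= udist x y.
Proof. by rewrite /udist le_max lexx. Qed.

Lemma udist_gt0 (R : realType) (V : metricType R) (x y : V) : 0 < udist x y.
Proof. exact: lt_le_trans ltr01 (udist_ge1 x y). Qed.

Lemma udistC (R : realType) (V : metricType R) (x y : V) : udist x y = udist y x.
Proof. by rewrite /udist metric_sym. Qed.

Lemma udist_triangle (R : realType) (V : metricType R) (x y z : V) :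
  udist x z <= udist x y + udist y z.
Proof.
have := udist_ge1 x y; have := udist_ge1 y z; have := metric_triangle x y z.
have : mdist x y <= udist x y by rewrite /udist le_max lexx orbT.
have : mdist y z <= udist y z by rewrite /udist le_max lexx orbT.
rewrite [X in _ -> _ -> _ -> _ -> _ -> X <= _]/udist ge_max => ? ? ? ? ?; apply/andP; split; lra.
Qed.

(** Split the points of s according to the k such that 2^k <= udist x w < 2^(k+1):
there are at most c2 2^((k+1) d) of them, each contributing at most f (2^k).
Sums over V are only considered through duplicate-free finite lists. *)
Lemma dyadic_sum (R : realType) (V : metricType R) (d c1 c2 : R)
    (Vg : volume_growth V d c1 c2) (f : R -> R) (x : V) (s : seq V) :
  (forall t, 1 <= t -> 0 <= f t) ->
  (forall t t', 1 <= t -> t <= t' -> f t' <= f t) -> uniq s ->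
  exists N, \sum_(w <- s) f (udist x w) <=
    \sum_(k < N) c2 * 2 `^ d * ((2 `^ d) ^+ k * f (2 ^+ k)).
Proof.
move=> f0 fanti us.
pose kappa w := trunc_log 2 (Num.trunc (udist x w)).
have kP w : 2 ^+ kappa w <= udist x w < 2 ^+ (kappa w).+1.
  exact: trunc_log2_bounds (udist_ge1 x w).
have p1 k : 1 <= 2 ^+ k :> R by rewrite exprn_ege1 // ler1n.
exists (\max_(w <- s) kappa w).+1.
set N := (X in \sum_(k < X) _).
have le1 : \sum_(w <- s) f (udist x w) <=
    \sum_(w <- s) \sum_(k < N | kappa w == k) f (2 ^+ k).
  rewrite big_seq [leRHS]big_seq; apply: ler_sum => w ws.
  have kN : (kappa w < N)%N by rewrite ltnS (@leq_bigmax_seq _ _ _ _ w).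
  rewrite (big_pred1 (Ordinal kN)) => [|k].
    by apply: fanti => //; case/andP: (kP w).
  by rewrite /= -val_eqE /= eq_sym.
apply: (le_trans le1).
rewrite (exchange_big_dep xpredT) //=; apply: ler_sum => k _.
rewrite big_const_seq iter_addr_0 -[X in X <= _]mulr_natl -size_filter mulrA.
apply: ler_wpM2r; first exact: f0.
have p2 : 1 <= 2 ^+ k.+1 :> R by [].
apply: (le_trans (ball_size Vg (x := x) p2 (filter_uniq _ us) _)) => [w|].
  rewrite mem_filter => /andP[/eqP kw _].
  case/andP: (kP w) => _; rewrite kw => /ltW; apply: le_trans.
  by rewrite /udist le_max lexx orbT.
by rewrite natX_powR exprS mulrA.
Qed.

(** Comparable to [g_kernel b] up to a factor 2. *)
Definition hker (R : realType) (V : metricType R) (b : R) (x y : V) : R :=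
  udist x y `^ (- b).

Lemma hker_ge0 (R : realType) (V : metricType R) (b : R) (x y : V) : 0 <= hker b x y.
Proof. exact: powR_ge0. Qed.

Lemma g_kernel_ge0 (R : realType) (V : metricType R) (b : R) (x y : V) :
  0 <= g_kernel b x y.
Proof. by rewrite /g_kernel divr_ge0 // addr_ge0 // powR_ge0. Qed.

Lemma g_kernelC (R : realType) (V : metricType R) (b : R) (x y : V) :
  g_kernel b x y = g_kernel b y x.
Proof. by rewrite /g_kernel metric_sym. Qed.

Lemma g_le_hker (R : realType) (V : metricType R) (b : R) (x y : V) :
  g_kernel b x y <= hker b x y.
Proof.
have p0 := powR_ge0 (mdist x y) b.
rewrite /g_kernel /hker /udist powRN div1r; case: (leP 1 (mdist x y)) => [m1|m1].
  rewrite lef_pV2 ?posrE ?powR_gt0 //; lra.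
by rewrite powR1 invr1 invf_le1; lra.
Qed.

Lemma hker_le_g (R : realType) (V : metricType R) (b : R) (x y : V) :
  0 <= b -> hker b x y <= 2 * g_kernel b x y.
Proof.
move=> b0; have p0 := powR_ge0 (mdist x y) b.
rewrite /g_kernel /hker /udist powRN mulrA mulr1 ler_pdivlMr; last lra.
case: (leP 1 (mdist x y)) => [m1|m1].
  have m1' : 1 <= mdist x y `^ b.
    by rewrite -[leLHS](powRr0 (mdist x y)) ler_powR.
  rewrite mulrDr mulr1 mulVf; last lra.
  suff : (mdist x y `^ b)^-1 <= 1 by lra.
  by rewrite invf_le1; lra.
have m1' : mdist x y `^ b <= 1.
  have := @ge0_ler_powR _ _ b0 (mdist x y) 1; rewrite powR1; apply; last exact: ltW.
    by rewrite nnegrE mdist_ge0.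
  by rewrite nnegrE.
rewrite powR1 invr1 mul1r; lra.
Qed.

(** With U = udist x y, the farther of x and y from w is at distance at least
U / 2, and also at least the distance t of w to the nearer one. Hence each term
is at most t^(-alpha) min (t^(-alpha), C U^(-alpha)), a decreasing function of t
whose sum over dyadic shells is of the order of U^(d - 2 alpha) by
[geometric_min], with a = 2^(d - alpha) and q = 2^(-alpha). *)
Lemma convolution (R : realType) (V : metricType R) (d c1 c2 alpha : R)
    (Vg : volume_growth V d c1 c2) :
  0 < c2 -> d / 2 < alpha -> alpha < d ->
  exists C, 0 < C /\ forall (x y : V) (s : seq V), uniq s ->
    \sum_(w <- s) hker alpha x w * hker alpha y w <= C * hker (2 * alpha - d) x y.
Proof.
move=> c20 ad da; have a0 : 0 < alpha by lra.
pose q : R := 2 `^ (- alpha); pose a : R := 2 `^ (d - alpha); pose M : R := 2 `^ alpha.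
have p2 : 0 < 2 :> R by [].
have q0 : 0 < q by exact: powR_gt0.
have gt1 b : 0 < b -> 1 < 2 `^ b :> R.
  move=> b0; have := @gt0_ltr_powR _ _ b0 1 2; rewrite powR1; apply; last by lra.
    by rewrite nnegrE.
  by rewrite nnegrE.
have a1 : 1 < a by apply: gt1; lra.
have M1 : 1 < M by apply: gt1.
have aqE : a * q = 2 `^ (- (2 * alpha - d)).
  rewrite /a /q -powRD; last by rewrite (_ : 2 != 0 :> R) ?implybT // gt_eqF.
  by congr (_ `^ _); lra.
have aq1 : a * q < 1.
  rewrite aqE powRN invf_lt1 ?powR_gt0 //; apply: gt1; lra.
pose D := a / (a - 1) + (1 - a * q)^-1.
have D0 : 0 < D by rewrite addr_gt0 ?divr_gt0 ?invr_gt0; lra.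
pose B := c2 * 2 `^ d * (M * (D * 2 `^ (2 * alpha - d))).
have B0 : 0 < B by rewrite !mulr_gt0 ?powR_gt0 //; lra.
exists (B + B); split; first lra.
move=> x y s us; set U := udist x y.
have U1 : 1 <= U by exact: udist_ge1.
pose f t := t `^ (- alpha) * Num.min (t `^ (- alpha)) (M * U `^ (- alpha)).
have f0 t : 1 <= t -> 0 <= f t.
  move=> _; rewrite mulr_ge0 ?powR_ge0 // le_min powR_ge0 mulr_ge0 ?powR_ge0 //.
have fanti t t' : 1 <= t -> t <= t' -> f t' <= f t.
  move=> t1 tt'; have h : t' `^ (- alpha) <= t `^ (- alpha) by apply: powRN_anti; lra.
  apply: ler_pM; rewrite ?powR_ge0 // ?le_min ?powR_ge0 ?mulr_ge0 ?powR_ge0 //.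
  by rewrite !ge_min lexx h orbT.
have fsum z : \sum_(w <- s) f (udist z w) <= B * U `^ (- (2 * alpha - d)).
  have [N /le_trans] := dyadic_sum Vg z f0 fanti us; apply.
  pose K := trunc_log 2 (Num.trunc U).
  have /andP[KU UK] : 2 ^+ K <= U < 2 ^+ K.+1 := trunc_log2_bounds U1.
  have fk k : (2 `^ d) ^+ k * f (2 ^+ k) <= M * (a ^+ k * Num.min (q ^+ k) (q ^+ K)).
    have Uq : U `^ (- alpha) <= q ^+ K.
      by rewrite /q -natX_powR; exact: powRN_anti (ltW a0) (exprn_gt0 K p2) KU.
    rewrite /f natX_powR -/q mulrA -exprMn.
    have -> : 2 `^ d * q = a.
      by rewrite /a /q powRD // (_ : 2 != 0 :> R) ?implybT // gt_eqF.
    rewrite [leRHS]mulrCA; apply: ler_wpM2l; first by rewrite exprn_ge0 //; lra.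
    rewrite minr_pMr; last lra.
    rewrite le_min !ge_min; apply/andP; split; apply/orP.
      by left; rewrite ler_peMl ?exprn_ge0 ?ltW.
    by right; rewrite ler_pM2l //; lra.
  apply: (@le_trans _ _ (\sum_(k < N) c2 * 2 `^ d *
      (M * (a ^+ k * Num.min (q ^+ k) (q ^+ K))))).
    apply: ler_sum => k _; apply: ler_wpM2l; last exact: fk.
    by rewrite mulr_ge0 ?powR_ge0 ?ltW.
  rewrite -!mulr_sumr /B -!mulrA.
  do 3 (apply: ler_wpM2l; first by rewrite ?powR_ge0 // ltW //; lra).
  apply: (le_trans (geometric_min K N a1 q0 aq1)); rewrite -/D.
  apply: ler_wpM2l; first exact: ltW.
  rewrite aqE -natX_powR; apply: powRN_half; [lra|lra|].
  by rewrite -exprS ltW.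
have pw w : hker alpha x w * hker alpha y w <= f (udist x w) + f (udist y w).
  rewrite /hker /f.
  have tri : U <= udist x w + udist y w.
    by rewrite (udistC y w); exact: udist_triangle.
  have := udist_ge1 x w; have := udist_ge1 y w.
  move: (udist x w) (udist y w) tri => u v tri v1 u1.
  have half t : U <= 2 * t -> t `^ (- alpha) <= M * U `^ (- alpha).
    by move=> h; apply: powRN_half; lra.
  have [uv|vu] := leP u v.
    rewrite ler_wpDr ?f0 //; apply: ler_wpM2l; first exact: powR_ge0.
    by rewrite le_min (powRN_anti _ _ uv) ?half; lra.
  rewrite ler_wpDl ?f0 // mulrC; apply: ler_wpM2l; first exact: powR_ge0.
  by rewrite le_min (powRN_anti _ _ (ltW vu)) ?half; lra.
apply: (le_trans (ler_sum _ (fun w _ => pw w))).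
by rewrite big_split /= mulrDl lerD.
Qed.

(** From d(z, x) <= d(z, w) + d(x, w) one gets
  h_alpha(z, w) h_alpha(x, w) <= C h_alpha(z, x) (h_alpha(z, w) + h_alpha(x, w)),
so the sum over w is at most two convolutions:
  C h_alpha(z, x) (h_b(z, y) + h_b(x, y)), with b = 2 alpha - d.
In the first term z is exchanged for x or y: if z is nearer to x than to y, then
h_b(z, y) is at most C h_b(x, y); otherwise, since b < alpha,
h_alpha(z, x) h_b(z, y) <= h_b(z, x) h_alpha(z, y) and h_b(z, x) is at most
C h_b(x, y). *)
Lemma star_sum (R : realType) (V : metricType R) (d c1 c2 alpha : R)
    (Vg : volume_growth V d c1 c2) :
  0 < c2 -> d / 2 < alpha -> alpha < d ->
  exists C, 0 < C /\ forall (x y z : V) (s : seq V), uniq s ->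
    \sum_(w <- s) g_kernel alpha z w * (g_kernel alpha x w * g_kernel alpha y w) <=
    C * (g_kernel (2 * alpha - d) x y * (g_kernel alpha x z + g_kernel alpha y z)).
Proof.
move=> c20 ad da; have a0 : 0 <= alpha by lra.
set b := 2 * alpha - d; have b0 : 0 <= b by rewrite /b; lra.
have [D [D0 conv]] := convolution Vg c20 ad da.
pose M : R := 2 `^ alpha; pose N : R := 2 `^ b.
have M0 : 0 < M by exact: powR_gt0.
have N0 : 0 < N by exact: powR_gt0.
pose E := M * D * (1 + N).
have E0 : 0 < E by rewrite !mulr_gt0 //; lra.
exists (E * 4); split; first by rewrite mulr_gt0.
move=> x y z s us.
have h0 e (u v : V) : 0 <= hker e u v by exact: hker_ge0.
have quasi w : hker alpha z w * hker alpha x w <=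
    M * hker alpha z x * (hker alpha z w + hker alpha x w).
  have tri : udist z x <= udist z w + udist x w.
    by rewrite (udistC x w); exact: udist_triangle.
  have half t : udist z x <= 2 * t -> t `^ (- alpha) <= M * hker alpha z x.
    by apply: powRN_half => //; exact: udist_gt0.
  have [zx|xz] := leP (udist z w) (udist x w).
    have h : hker alpha x w <= M * hker alpha z x by apply: half; lra.
    rewrite mulrDr ler_wpDr ?mulr_ge0 ?(ltW M0) // mulrC.
    exact: ler_wpM2r.
  have h : hker alpha z w <= M * hker alpha z x by apply: half; lra.
  rewrite mulrDr ler_wpDl ?mulr_ge0 ?(ltW M0) //.
  exact: ler_wpM2r.
have exch : hker alpha z x * hker b z y <=
    N * hker b x y * (hker alpha z x + hker alpha z y).
  have tri : udist x y <= udist z x + udist z y.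
    by rewrite (udistC z x); exact: udist_triangle.
  have half t : udist x y <= 2 * t -> t `^ (- b) <= N * hker b x y.
    by apply: powRN_half => //; exact: udist_gt0.
  rewrite mulrDr; have [xy|yx] := leP (udist z x) (udist z y).
    have h : hker b z y <= N * hker b x y by apply: half; lra.
    rewrite ler_wpDr ?mulr_ge0 ?(ltW N0) // mulrC.
    exact: ler_wpM2r.
  have h : hker b z x <= N * hker b x y by apply: half; lra.
  rewrite ler_wpDl ?mulr_ge0 ?(ltW N0) //.
  apply: (@le_trans _ _ (hker b z x * hker alpha z y)); last exact: ler_wpM2r.
  have split u : 0 < u -> u `^ (- alpha) = u `^ (- b) * u `^ (- (alpha - b)).
    move=> u0; rewrite -powRD; last by rewrite (gt_eqF u0) implybT.
    by congr (_ `^ _); lra.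
  rewrite /hker !split ?udist_gt0 // -mulrA; apply: ler_wpM2l; first exact: powR_ge0.
  rewrite mulrC; apply: ler_wpM2l; first exact: powR_ge0.
  by apply: powRN_anti; rewrite ?udist_gt0 ?ltW // /b; lra.
apply: (@le_trans _ _
    (\sum_(w <- s) hker alpha z w * (hker alpha x w * hker alpha y w))).
  apply: ler_sum => w _.
  apply: ler_pM; [exact: g_kernel_ge0| |exact: g_le_hker|].
    by apply: mulr_ge0; exact: g_kernel_ge0.
  by apply: ler_pM; do ?[exact: g_kernel_ge0|exact: g_le_hker].
apply: (@le_trans _ _ (\sum_(w <- s) M * hker alpha z x *
    (hker alpha z w * hker alpha y w + hker alpha x w * hker alpha y w))).
  apply: ler_sum => w _; rewrite mulrA -mulrDl mulrA.
  exact: ler_wpM2r.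
rewrite -mulr_sumr big_split /=.
apply: (@le_trans _ _ (M * hker alpha z x * (D * hker b z y + D * hker b x y))).
  apply: ler_wpM2l; first by rewrite mulr_ge0 ?(ltW M0).
  by apply: lerD; exact: conv.
apply: (@le_trans _ _ (E * (hker b x y * (hker alpha z x + hker alpha z y)))).
  have -> : M * hker alpha z x * (D * hker b z y + D * hker b x y) =
    M * D * (hker alpha z x * hker b z y + hker b x y * hker alpha z x) by lra.
  rewrite /E -[leRHS]mulrA; apply: ler_wpM2l; first by apply: mulr_ge0; exact: ltW.
  rewrite [leRHS]mulrDl mul1r [leRHS]addrC; apply: lerD; first by rewrite mulrA.
  by apply: ler_wpM2l => //; rewrite lerDl.
rewrite -[leRHS]mulrA; apply: ler_wpM2l; first exact: ltW.
have -> : 4 * (g_kernel b x y * (g_kernel alpha x z + g_kernel alpha y z)) =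
  2 * g_kernel b x y * (2 * g_kernel alpha z x + 2 * g_kernel alpha z y).
  rewrite (g_kernelC alpha x z) (g_kernelC alpha y z); lra.
apply: ler_pM; rewrite ?addr_ge0 ?hker_ge0 ?hker_le_g //.
by apply: lerD; apply: hker_le_g.
Qed.

(** * Sums over binary trees *)

(** Binary trees of depth at most m with labelled leaves, as an explicit list so
that all sums over trees are finite sums in R; distinctness of the labels is
imposed afterwards by [labelled_by]. *)
Fixpoint bintrees (I : finType) (m : nat) : seq (ltree I) :=
  [seq Leaf i | i <- enum I] ++
  (if m is m'.+1 then
     [seq Branch t1 t2 [::] | t1 <- bintrees I m', t2 <- bintrees I m'] else [::]).

Lemma bintrees_uniq (I : finType) (m : nat) : uniq (bintrees I m).
Proof.
have uL : uniq [seq Leaf i | i <- enum I] by rewrite map_inj_uniq ?enum_uniq // => i j [].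
elim: m => [|m IH]; first by rewrite /= cats0.
rewrite /= cat_uniq uL; apply/and3P; split => //.
  by apply/hasPn => _ /allpairsP[[t1 t2] [_ _ ->]]; apply/mapP => -[].
by apply: allpairs_uniq => // -[a b] [c e] _ _ [-> ->].
Qed.

Lemma Leaf_bintrees (I : finType) (m : nat) (i : I) : Leaf i \in bintrees I m.
Proof.
by case: m => [|m] /=; rewrite mem_cat map_f // mem_enum.
Qed.

Lemma rroot_pi_tree (I : Type) (t : ltree I) : rroot (pi_tree t) = first_label t.
Proof. by elim: t. Qed.

Definition tree_weight (R : realType) (V : metricType R) (alpha d : R) (n : nat)
    (x : 'I_n -> V) (z : V) (t : ltree 'I_n) : R :=
  G_tree alpha d t x * g_kernel alpha (x (first_label t)) z.

Lemma G_tree_ge0 (R : realType) (V : metricType R) (alpha d : R) (n : nat)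
    (x : 'I_n -> V) (t : ltree 'I_n) : 0 <= G_tree alpha d t x.
Proof. by apply: prodr_ge0 => e _; exact: g_kernel_ge0. Qed.

Lemma tree_weight_ge0 (R : realType) (V : metricType R) (alpha d : R) (n : nat)
    (x : 'I_n -> V) (z : V) (t : ltree 'I_n) : 0 <= tree_weight alpha d x z t.
Proof. by rewrite mulr_ge0 ?G_tree_ge0 ?g_kernel_ge0. Qed.

Lemma G_tree_Branch (R : realType) (V : metricType R) (alpha d : R) (n : nat)
    (x : 'I_n -> V) (t1 t2 : ltree 'I_n) :
  G_tree alpha d (Branch t1 t2 [::]) x =
  g_kernel (2 * alpha - d) (x (first_label t1)) (x (first_label t2)) *
  (G_tree alpha d t1 x * G_tree alpha d t2 x).
Proof.
by rewrite /G_tree /= big_cons cats0 big_cat /= !rroot_pi_tree.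
Qed.

Definition labelled_by (I : finType) (S : {set I}) (t : ltree I) : bool :=
  perm_eq (labels t) (enum S).

Definition tree_sum (R : realType) (V : metricType R) (alpha d : R) (n : nat)
    (x : 'I_n -> V) (m : nat) (S : {set 'I_n}) (z : V) : R :=
  \sum_(t <- bintrees 'I_n m | labelled_by S t) tree_weight alpha d x z t.

Lemma labels_split (I : finType) (S J : {set I}) (t1 t2 : ltree I) :
  J \subset S -> labelled_by J t1 -> labelled_by (S :\: J) t2 ->
  perm_eq (labels t1 ++ labels t2) (enum S).
Proof.
move=> JS h1 h2; apply: (perm_trans (perm_cat h1 h2)).
apply: uniq_perm; last 2 first.
- exact: enum_uniq.
- move=> i; rewrite mem_cat !mem_enum !inE.
  case: (boolP (i \in J)) => //= iJ; by rewrite (fintype.subsetP JS).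
rewrite cat_uniq !enum_uniq andbT /=.
by apply/hasPn => i; rewrite !mem_enum !inE => /andP[].
Qed.

(** A pair of trees with disjoint labels exhausting S arises from one splitting J
only, namely from the set of labels of t1. *)
Lemma sum_splittings (R : realType) (I : finType) (S : {set I}) (r : seq (ltree I))
    (F : ltree I -> ltree I -> R) :
  (forall t1 t2, 0 <= F t1 t2) ->
  \sum_(J : {set I} | (J \proper S) && (J != finset.set0))
    \sum_(t1 <- r | labelled_by J t1) \sum_(t2 <- r | labelled_by (S :\: J) t2) F t1 t2 <=
  \sum_(t1 <- r) \sum_(t2 <- r | perm_eq (labels t1 ++ labels t2) (enum S)) F t1 t2.
Proof.
move=> F0.
under eq_bigr do rewrite big_mkcond /=.
rewrite exchange_big /=; apply: ler_sum => t1 _.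
under eq_bigr do rewrite (fun_if (fun u => u)) big_mkcond /=.
have -> : \sum_(J : {set I} | (J \proper S) && (J != finset.set0))
   (if labelled_by J t1 then
    \sum_(t2 <- r) (if labelled_by (S :\: J) t2 then F t1 t2 else 0) else 0) =
   \sum_(t2 <- r) \sum_(J : {set I} | (J \proper S) && (J != finset.set0))
     (if labelled_by J t1 && labelled_by (S :\: J) t2 then F t1 t2 else 0).
  rewrite [RHS]exchange_big /=; apply: eq_bigr => J _.
  by case: ifP => // _; rewrite big1.
rewrite [leRHS]big_mkcond; apply: ler_sum => t2 _.
rewrite big_mkcond /=.
pose c := perm_eq (labels t1 ++ labels t2) (enum S).
apply: (@le_trans _ _ (\sum_(J : {set I} | J == [set i in labels t1]%SET)
    (if c then F t1 t2 else 0))); last by rewrite big_pred1_eq.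
rewrite [leRHS]big_mkcond; apply: ler_sum => J _.
case: ifP => [/andP[JS _]|_]; last by case: ifP => // _; case: ifP.
case: ifP => [/andP[l1 l2]|_]; last by case: ifP => // _; case: ifP.
rewrite /c (labels_split (proper_sub JS) l1 l2) (_ : J == _) //.
by apply/eqP/setP => i; rewrite inE (perm_mem l1) mem_enum.
Qed.

Lemma tree_sum_branch (R : realType) (V : metricType R) (alpha d : R) (n : nat)
    (x : 'I_n -> V) (m : nat) (S : {set 'I_n}) (z : V) :
  \sum_(t1 <- bintrees 'I_n m)
    \sum_(t2 <- bintrees 'I_n m | perm_eq (labels t1 ++ labels t2) (enum S))
      tree_weight alpha d x z (Branch t1 t2 [::]) <= tree_sum alpha d x m.+1 S z.
Proof.
rewrite /tree_sum /= big_cat /= ler_wpDl //.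
  by apply: sumr_ge0 => t _; exact: tree_weight_ge0.
rewrite [leRHS]big_mkcond big_allpairs_dep; apply: ler_sum => t1 _.
by rewrite [leLHS]big_mkcond; apply: ler_sum => t2 _; rewrite /labelled_by /= cats0.
Qed.

Lemma tree_sum_leaf (R : realType) (V : metricType R) (alpha d : R) (n : nat)
    (x : 'I_n -> V) (m : nat) (i : 'I_n) (z : V) :
  g_kernel alpha (x i) z <= tree_sum alpha d x m [set i]%SET z.
Proof.
rewrite /tree_sum big_mkcond (big_rem _ (Leaf_bintrees m i)) /=.
rewrite {1}/labelled_by enum_set1 perm_refl /tree_weight /G_tree /= big_nil mul1r lerDl.
by apply: sumr_ge0 => t _; case: ifP => // _; exact: tree_weight_ge0.
Qed.

(** * Union bounds and the BK inequality *)

Lemma le_measure_bigsetU d (T : measurableType d) (R : realType)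
    (P : {measure set T -> \bar R}) (I : Type) (r : seq I) (c : pred I) (F : I -> set T) :
  (forall i, measurable (F i)) ->
  (P (\big[setU/set0]_(i <- r | c i) F i) <= \sum_(i <- r | c i) P (F i))%E.
Proof.
move=> mF; elim: r => [|i r IH]; first by rewrite !big_nil measure0.
rewrite !big_cons; case: ifP => // _.
apply: (le_trans (measureU2 _ _ _)) => //; first exact: bigsetU_measurable.
exact: leeD2l.
Qed.

(** Bounding the sums over finite lists suffices, the series of an enumeration of V
being a limit of such sums. *)
Lemma countable_union_bound d (T : measurableType d) (R : realType)
    (P : {measure set T -> \bar R}) (V : eqType) (F : V -> set T) (A : set T)
    (B : \bar R) :
  countable [set: V] -> measurable A -> (forall v, measurable (F v)) ->
  A `<=` \bigcup_v F v ->
  (forall s : seq V, uniq s -> (\sum_(v <- s) P (F v) <= B)%E) -> (P A <= B)%E.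
Proof.
move=> /countable_injP[f finj] mA mF AF sB.
have {}finj : injective f by move=> a b; apply: finj; rewrite in_setT.
(* A partial inverse of the injection f of V into nat. *)
pose dec n : option V :=
  if pselect (exists v, f v = n) is left h then Some (sval (cid h)) else None.
have decK : ocancel dec f.
  by move=> n; rewrite /dec; case: pselect => //= h; exact: svalP (cid h).
have decf v : dec (f v) = Some v.
  rewrite /dec; case: pselect => [h|[]]; last by exists v.
  by congr Some; apply: finj; exact: svalP (cid h).
pose F' n := if dec n is Some v then F v else set0.
have mF' n : measurable (F' n) by rewrite /F'; case: (dec n).
apply: (@le_trans _ _ (\sum_(0 <= n <oo) P (F' n))%E).
  apply: (measure_sigma_subadditive P mF' mA) => t /AF[v _ Fv].
  by exists (f v) => //; rewrite /F' decf.
apply: lime_le; first by apply: is_cvg_nneseries => n _ _; exact: measure_ge0.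
apply: nearW => N.
have -> : (\sum_(0 <= n < N) P (F' n) = \sum_(v <- pmap dec (iota 0 N)) P (F v))%E.
  rewrite /index_iota subn0; elim: (iota 0 N) => [|n s IH]; first by rewrite !big_nil.
  rewrite big_cons IH /= /F'; case: (dec n) => [v|] /=; first by rewrite big_cons.
  by rewrite measure0 add0e.
by apply: sB; apply: (pmap_uniq decK); exact: iota_uniq.
Qed.

Definition branch_event (V : eqType) (I : finType) (x : I -> V) (S J : {set I})
    (z w : V) : set (graph_space V) :=
  disjoint_occ [set A : sgraph V | connected_in A z w]
    (disjoint_occ (hits x J w) (hits x (S :\: J) w)).

Lemma BK_branch (R : realType) (disp : measure_display)
    (Omega : measurableType disp) (V : eqType) (P : probability Omega R)
    (G : {mfun Omega >-> graph_space V}) (I : finType) (x : I -> V)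
    (S J : {set I}) (z w : V) :
  countable [set: V] -> BK_inequality P G ->
  (P (G @^-1` branch_event x S J z w) <= tau P G z w *
    (P (G @^-1` hits x J w) * P (G @^-1` hits x (S :\: J) w)))%E.
Proof.
move=> cV BK; have ge0 A : (0 <= P A)%E by exact: measure_ge0.
apply: (le_trans (BK _ _ _ _ _ _)).
- by apply: finitary_measurable => //; exact: finitary_connected.
- exact: disjoint_occ_measurable.
- by move=> A cA B AB; exact: connected_sub cA.
- exact: disjoint_occ_increasing.
apply: lee_pmul => //.
by apply: BK; [exact: hits_measurable..|exact: hits_increasing|exact: hits_increasing].
Qed.

Lemma hits_union_bound (R : realType) (disp : measure_display)
    (Omega : measurableType disp) (V : eqType) (P : probability Omega R)
    (G : {mfun Omega >-> graph_space V}) (I : finType) (x : I -> V)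
    (S : {set I}) (z : V) (B : \bar R) :
  countable [set: V] -> (1 < #|S|)%N ->
  (forall s : seq V, uniq s -> (\sum_(w <- s)
     \sum_(J : {set I} | (J \proper S) && (J != finset.set0))
       P (G @^-1` branch_event x S J z w) <= B)%E) ->
  (P (G @^-1` hits x S z) <= B)%E.
Proof.
move=> cV S2 sB.
have mE J w : measurable (G @^-1` branch_event x S J z w).
  by apply: measurable_funPTI; exact: disjoint_occ_measurable.
pose F w := \big[setU/set0]_(J : {set I} | (J \proper S) && (J != finset.set0))
  (G @^-1` branch_event x S J z w).
apply: (@countable_union_bound _ _ _ P _ F) => //.
- by apply: measurable_funPTI; exact: hits_measurable.
- by move=> w; exact: bigsetU_measurable.
- move=> om /(hits_disjoint_occ S2)[w [J [JS J0 H]]]; exists w => //.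
  by rewrite /F (bigD1 J) ?JS ?J0 //; left.
move=> s us; apply: le_trans (sB s us); apply: lee_sum => w _.
exact: le_measure_bigsetU.
Qed.

(** * Induction on the number of points *)

(** The induction step for the right-hand side: [star_sum] turns the pair (t1, t2)
into the two trees that graft t1 and t2 on a common root, and each tree so
obtained is counted at most twice. *)
Lemma branch_sum (R : realType) (V : metricType R) (alpha d C : R) (n : nat)
    (x : 'I_n -> V) (m : nat) (S : {set 'I_n}) (z : V) (s : seq V) :
  0 <= C ->
  (forall x y z : V,
    \sum_(w <- s) g_kernel alpha z w * (g_kernel alpha x w * g_kernel alpha y w) <=
    C * (g_kernel (2 * alpha - d) x y * (g_kernel alpha x z + g_kernel alpha y z))) ->
  \sum_(w <- s) \sum_(J : {set 'I_n} | (J \proper S) && (J != finset.set0))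
    g_kernel alpha z w * (tree_sum alpha d x m J w * tree_sum alpha d x m (S :\: J) w)
  <= 2 * C * tree_sum alpha d x m.+1 S z.
Proof.
move=> C0 star.
pose W := tree_weight alpha d x z.
pose F t1 t2 := W (Branch t1 t2 [::]) + W (Branch t2 t1 [::]).
have F0 t1 t2 : 0 <= F t1 t2 by rewrite addr_ge0 ?tree_weight_ge0.
have pair t1 t2 : \sum_(w <- s) g_kernel alpha z w *
    (tree_weight alpha d x w t1 * tree_weight alpha d x w t2) <= C * F t1 t2.
  pose g0 := G_tree alpha d t1 x * G_tree alpha d t2 x.
  have g00 : 0 <= g0 by rewrite mulr_ge0 ?G_tree_ge0.
  rewrite (eq_bigr (fun w => g0 * (g_kernel alpha z w *
    (g_kernel alpha (x (first_label t1)) w * g_kernel alpha (x (first_label t2)) w)))).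
    rewrite -mulr_sumr; apply: (le_trans (ler_wpM2l g00 (star _ _ _))).
    rewrite /F /W /tree_weight !G_tree_Branch /=.
    rewrite (g_kernelC _ (x (first_label t2)) (x (first_label t1))) -/g0.
    rewrite (mulrC (G_tree alpha d t2 x)) -/g0; lra.
  move=> w _; rewrite /tree_weight /g0; lra.
have expand w J : g_kernel alpha z w *
    (tree_sum alpha d x m J w * tree_sum alpha d x m (S :\: J) w) =
  \sum_(t1 <- bintrees 'I_n m | labelled_by J t1)
    \sum_(t2 <- bintrees 'I_n m | labelled_by (S :\: J) t2)
    g_kernel alpha z w * (tree_weight alpha d x w t1 * tree_weight alpha d x w t2).
  rewrite /tree_sum mulr_suml mulr_sumr; apply: eq_bigr => t1 _.
  by rewrite !mulr_sumr.
have swap1 : \sum_(w <- s) \sum_(J : {set 'I_n} | (J \proper S) && (J != finset.set0))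
    g_kernel alpha z w * (tree_sum alpha d x m J w * tree_sum alpha d x m (S :\: J) w)
   = \sum_(J : {set 'I_n} | (J \proper S) && (J != finset.set0))
     \sum_(t1 <- bintrees 'I_n m | labelled_by J t1)
     \sum_(t2 <- bintrees 'I_n m | labelled_by (S :\: J) t2)
     \sum_(w <- s) g_kernel alpha z w *
      (tree_weight alpha d x w t1 * tree_weight alpha d x w t2).
  rewrite exchange_big; apply: eq_bigr => J _.
  under eq_bigr do rewrite expand.
  rewrite exchange_big; apply: eq_bigr => t1 _.
  by rewrite exchange_big.
rewrite swap1.
apply: (@le_trans _ _ (\sum_(J : {set 'I_n} | (J \proper S) && (J != finset.set0))
     \sum_(t1 <- bintrees 'I_n m | labelled_by J t1)
     \sum_(t2 <- bintrees 'I_n m | labelled_by (S :\: J) t2) C * F t1 t2)).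
  by do 3 (apply: ler_sum => ? _); exact: pair.
apply: (le_trans (sum_splittings (F := fun t1 t2 => C * F t1 t2) _ _ _)).
  by move=> t1 t2; rewrite mulr_ge0.
have h1 := tree_sum_branch alpha d x m S z.
have h2 : \sum_(t1 <- bintrees 'I_n m)
    \sum_(t2 <- bintrees 'I_n m | perm_eq (labels t1 ++ labels t2) (enum S))
      W (Branch t2 t1 [::]) <= tree_sum alpha d x m.+1 S z.
  apply: le_trans h1; rewrite (exchange_big_dep xpredT) //=; apply: ler_sum => t1 _.
  by under eq_bigl do rewrite perm_catC.
under eq_bigr do rewrite -mulr_sumr big_split /=.
rewrite -mulr_sumr big_split /=.
have := ler_wpM2l C0 (lerD h1 h2); lra.
Qed.

(** The constant: a splitting contributes C0 for the connection from z to w, and the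
two parts contribute C0 each, while the bound to be reached has a single C0; the
excess C0^2 and the factor 2 C of [branch_sum] are charged to the one additional
power of 2 C0^2 C. A binary tree with #|S| leaves has depth less than #|S|, which
is the reason for the hypothesis on m. *)
Lemma hits_bound (R : realType) (V : metricType R) (disp : measure_display)
    (Omega : measurableType disp) (P : probability Omega R)
    (G : {mfun Omega >-> graph_space V}) (alpha d C0 C : R) :
  countable [set: V] -> BK_inequality P G -> 0 < C0 -> 0 < C ->
  (forall x y : V, (tau P G x y <= (C0 * g_kernel alpha x y)%:E)%E) ->
  (forall (x y z : V) (s : seq V), uniq s ->
    \sum_(w <- s) g_kernel alpha z w * (g_kernel alpha x w * g_kernel alpha y w) <=
    C * (g_kernel (2 * alpha - d) x y * (g_kernel alpha x z + g_kernel alpha y z))) ->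
  forall n (x : 'I_n -> V) m (S : {set 'I_n}) z, (0 < #|S|)%N -> (#|S| <= m.+1)%N ->
  (P (G @^-1` hits x S z) <=
    (C0 * (2 * C0 ^+ 2 * C) ^+ #|S|.-1 * tree_sum alpha d x m S z)%:E)%E.
Proof.
move=> cV BK C00 Cp Gtau star n x; set K := 2 * C0 ^+ 2 * C.
have K0 : 0 < K by rewrite !mulr_gt0 ?exprn_gt0.
have single m (S : {set 'I_n}) z : #|S| = 1%N -> (P (G @^-1` hits x S z) <=
    (C0 * K ^+ #|S|.-1 * tree_sum alpha d x m S z)%:E)%E.
  move=> S1; rewrite S1 expr0 mulr1; have /eqP/cards1P[i ->] := S1.
  have -> : G @^-1` hits x [set i]%SET z = [set w | connected_in (G w) z (x i)].
    apply/seteqP; split=> om /= h; first by apply: h; rewrite inE.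
    by move=> j; rewrite inE => /eqP ->.
  apply: (le_trans (Gtau _ _)); rewrite lee_fin ler_pM2l // g_kernelC.
  exact: tree_sum_leaf.
elim=> [|m IH] S z S0 Sm.
  by apply: single; apply/eqP; rewrite eqn_leq Sm.
have [S1|S2] := leqP #|S| 1; first by apply: single; apply/eqP; rewrite eqn_leq S1.
apply: hits_union_bound => // s us.
pose T J w := tree_sum alpha d x m J w.
have T0 J w : 0 <= T J w by apply: sumr_ge0 => t _; exact: tree_weight_ge0.
have step w (J : {set 'I_n}) : (J \proper S) && (J != finset.set0) ->
    (P (G @^-1` branch_event x S J z w) <=
     (C0 ^+ 3 * K ^+ #|S|.-2 * (g_kernel alpha z w * (T J w * T (S :\: J) w)))%:E)%E.
  move=> /andP[JS J0]; have ge0 A : (0 <= P A)%E by exact: measure_ge0.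
  have cJ : (0 < #|J|)%N by rewrite card_gt0.
  have cJS := proper_card JS.
  have cD : #|S :\: J| = (#|S| - #|J|)%N by rewrite cardsDS // proper_sub.
  have cD0 : (0 < #|S :\: J|)%N by rewrite cD subn_gt0.
  have cJm : (#|J| <= m.+1)%N by rewrite -ltnS (leq_trans cJS).
  have cDm : (#|S :\: J| <= m.+1)%N.
    by rewrite cD -ltnS (leq_trans _ Sm) // ltn_subrL cJ (leq_trans cJ (ltnW cJS)).
  apply: (le_trans (BK_branch _ _ _ _ _ cV BK)).
  apply: (le_trans (lee_pmul _ _ (Gtau z w)
    (lee_pmul _ _ (IH J w cJ cJm) (IH (S :\: J) w cD0 cDm)))) => //.
    by rewrite mule_ge0.
  rewrite -!EFinM lee_fin -/(T J w) -/(T (S :\: J) w).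
  have -> : #|S|.-2 = (#|J|.-1 + #|S :\: J|.-1)%N.
    by rewrite cD -{1}(subnKC (ltnW cJS)) -cD -(prednK cJ) -(prednK cD0) addSn addnS.
  rewrite exprD; set a := K ^+ _; set b := K ^+ _; rewrite le_eqVlt; apply/orP; left.
  by apply/eqP; rewrite !exprS expr0; lra.
apply: (@le_trans _ _ (\sum_(w <- s)
   \sum_(J : {set 'I_n} | (J \proper S) && (J != finset.set0))
   (C0 ^+ 3 * K ^+ #|S|.-2 * (g_kernel alpha z w * (T J w * T (S :\: J) w)))%:E)%E).
  by apply: lee_sum => w _; apply: lee_sum => J; exact: step.
under eq_bigr do rewrite sumEFin.
rewrite sumEFin lee_fin.
under eq_bigr do rewrite -mulr_sumr.
rewrite -mulr_sumr.
have h := @branch_sum _ _ alpha d C n x m S z s (ltW Cp) (fun x y z => star x y z s us).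
have k0 : 0 <= C0 ^+ 3 * K ^+ #|S|.-2 by rewrite mulr_ge0 ?exprn_ge0 ?ltW.
apply: (le_trans (ler_wpM2l k0 h)).
have -> : #|S|.-1 = #|S|.-2.+1 by rewrite prednK // -subn1 subn_gt0.
rewrite (exprS K) {2}/K; set a := K ^+ _; set t := tree_sum _ _ _ _ _ _.
rewrite le_eqVlt; apply/orP; left; apply/eqP; rewrite !exprS expr0; lra.
Qed.

Theorem proposition7p1 (R : realType) (V : metricType R)
  (V_countable : countable [set: V])
  (d c1 c2 : R) (d_ge1 : 1 <= d) (c1_gt0 : 0 < c1) (c2_gt0 : 0 < c2)
  (V_growth : volume_growth V d c1 c2)
  (disp : measure_display) (Omega : measurableType disp)
  (P : probability Omega R) (G : {mfun Omega >-> graph_space V})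
  (G_BK : BK_inequality P G)
  (alpha C0 : R) (alpha_gt : d / 2 < alpha) (alpha_lt : alpha < d)
  (C0_gt0 : 0 < C0)
  (G_tau : forall x y : V, (tau P G x y <= (C0 * g_kernel alpha x y)%:E)%E) :
  exists C : R, 0 < C /\
    forall (n : nat), (1 <= n)%N -> forall (x : 'I_n -> V) (z : V),
      (P [set w | forall i : 'I_n, component (G w) z (x i)] <=
       (C ^+ n)%:E *
       \esum_(t in plane_trees n) (G_tree alpha d t x * g_kernel alpha (x (first_label t)) z)%:E)%E.
Proof.
have [C [C_gt0 star]] := star_sum V_growth c2_gt0 alpha_gt alpha_lt.
pose K := 2 * C0 ^+ 2 * C; have K0 : 0 < K by rewrite !mulr_gt0 ?exprn_gt0.
exists (C0 + K); split; first exact: addr_gt0.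
move=> n n1 x z.
have cT : #|[set: 'I_n]%SET| = n by rewrite cardsT card_ord.
have := hits_bound V_countable G_BK C0_gt0 C_gt0 G_tau star (m := n.-1) x (S := [set: 'I_n]%SET) z.
rewrite cT prednK // => /(_ n1 (leqnn _)).
have -> : G @^-1` hits x [set: 'I_n]%SET z =
    [set w | forall i : 'I_n, component (G w) z (x i)].
  by apply/seteqP; split=> om h i; [exact: (h i (finset.in_setT i))|move=> _; exact: h].
move=> /le_trans; apply; rewrite -/K EFinM; apply: lee_pmul.
- by rewrite lee_fin mulr_ge0 ?exprn_ge0 ?ltW.
- by rewrite lee_fin; apply: sumr_ge0 => t _; exact: tree_weight_ge0.
- rewrite lee_fin -[in leRHS](prednK n1) exprS.
  apply: ler_pM; [exact: ltW|by rewrite exprn_ge0 ?ltW|by rewrite lerDl ltW|].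
  by rewrite lerXn2r ?nnegrE ?addr_ge0 ?lerDr ?(ltW C0_gt0) ?(ltW K0).
apply: esum_ge; pose s := [seq t <- bintrees 'I_n n.-1 | labelled_by [set: 'I_n]%SET t].
exists [set` s].
  split; first exact: finite_seq.
  move=> t /=; rewrite mem_filter => /andP[+ _].
  by rewrite /labelled_by /plane_trees /= enum_setT -enumT.
rewrite -fsbig_seq /=; last by rewrite filter_uniq ?bintrees_uniq.
by rewrite /tree_sum -sumEFin big_filter.
Qed.
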